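(* Let $\delta>0$ and $\epsilon>0$, and let $I_0=(-3\delta,-\delta]\cup[\epsilon,3\epsilon)$. For every function $y_0:I_0\to\mathbb{R}$ there is a unique function $y:\mathbb{R}\to\mathbb{R}$ such that $y(3x)=y(x)+y(2x)$ for all $x\in\mathbb{R}$ and $y(x)=y_0(x)$ for all $x\in I_0$.
   Context: No continuity is assumed. *)

(* Defs.v *)
From HB Require Import structures.
From mathcomp Require Import all_boot all_order all_algebra.
From mathcomp Require Import all_classical all_reals.
Set Implicit Arguments. Unset Strict Implicit. Unset Printing Implicit Defensive.
Import Order.TTheory GRing.Theory Num.Theory.
Local Open Scope classical_set_scope.
Local Open Scope ring_scope.

Definition I0 (R : realType) (delta eps : R) : set R :=
  `]- (3 * delta), - delta] `|` `[eps, 3 * eps[.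

(* Main.v *)
Require Import Defs.
From mathcomp Require Import all_boot all_order all_algebra.
From mathcomp Require Import all_classical all_reals.
From mathcomp Require Import lra.
Import Order.TTheory GRing.Theory Num.Theory.
Local Open Scope classical_set_scope.
Local Open Scope ring_scope.

(** Each half-line is invariant under x -> 2x and x -> 3x, so the two half-lines
    decouple, and y 0 = 0 is forced. On the positive half-line, the instance of
    the equation at x determines y (3x) from the smaller points x and 2x when
    eps <= x, and determines y x from the larger points 2x and 3x when x < eps.
    Each instance is used exactly once, and iterating either rule leads back to
    [eps, 3 eps) after finitely many steps. The negative half-line is reduced
    to the positive one by x -> - x. *)

(* [depth e n x] ensures that [n] steps of the recursion lead from [x] into
   [[e, 3e)]. The true ranges grow geometrically with [n]; these linear
   underestimates are still preserved by the recursion. *)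
Definition depth {R : realType} (e : R) (n : nat) (x : R) : Prop :=
  e <= (n%:R + 1) * x /\ x < (n%:R + 3) * e.

(** The recursion is not structural in [x], so [n] serves as fuel. When it runs out the value [f x]
    is returned, which is meaningful only if [x] has reached [[e, 3e)]; [depth e n x] guarantees
    this. *)
Fixpoint extend {R : realType} (e : R) (f : R -> R) (n : nat) (x : R) : R :=
  if n is k.+1 then
    if x < e then extend e f k (3 * x) - extend e f k (2 * x)
    else if x < 3 * e then f x
    else extend e f k (x / 3) + extend e f k (2 * (x / 3))
  else f x.

Lemma depth0 {R : realType} {e : R} (x : R) : depth e 0 x -> e <= x < 3 * e.
Proof. by rewrite /depth !add0r mul1r => -[-> ->]. Qed.

Lemma depth_ex {R : realType} {e : R} (x : R) :
  0 < e -> 0 < x -> exists n, depth e n x.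
Proof.
move=> e_gt0 x_gt0.
have [a ha] : exists a : nat, e < a%:R * x.
  exists (Num.bound (e / x)).
  by rewrite -ltr_pdivrMr // archi_boundP // divr_ge0 // ltW.
have [b hb] : exists b : nat, x < b%:R * e.
  exists (Num.bound (x / e)).
  by rewrite -ltr_pdivrMr // archi_boundP // divr_ge0 // ltW.
have ae : 0 <= a%:R * e by rewrite mulr_ge0 // ltW.
have bx : 0 <= b%:R * x by rewrite mulr_ge0 // ltW.
(* [a] handles the lower bound and [b] the upper one; the cross terms are nonnegative. *)
by exists (a + b)%N; rewrite /depth natrD; split; lra.
Qed.

Lemma depth_small {R : realType} {e : R} {n : nat} {x : R} :
  0 < e -> x < e -> depth e n.+1 x ->
  depth e n (3 * x) /\ depth e n (2 * x).
Proof.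
rewrite /depth -(natr1 n) => e_gt0 xe [h1 h2].
have n_ge0 : 0 <= n%:R :> R by [].
have x_gt0 : 0 < x by rewrite -(@pmulr_rgt0 _ (n%:R + 1 + 1)); lra.
have h3 : 0 <= n%:R * x by rewrite mulr_ge0 // ltW.
have h4 : 0 <= n%:R * e by rewrite mulr_ge0 // ltW.
by split; split; lra.
Qed.

Lemma depth_large {R : realType} {e : R} {n : nat} {x : R} :
  0 < e -> 3 * e <= x -> depth e n.+1 x ->
  depth e n (x / 3) /\ depth e n (2 * (x / 3)).
Proof.
rewrite /depth -(natr1 n) => e_gt0 xe [h1 h2].
have n_ge0 : 0 <= n%:R :> R by [].
have h3 : 0 <= n%:R * (x - 3 * e) by apply: mulr_ge0; lra.
have h4 : 0 <= n%:R * e by rewrite mulr_ge0 // ltW.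
by split; split; lra.
Qed.

Lemma extend_base {R : realType} {e : R} (f : R -> R) (n : nat) (x : R) :
  e <= x < 3 * e -> extend e f n x = f x.
Proof. by case: n => [//|n] /andP[ex xe] /=; rewrite ltNge ex /= xe. Qed.

(** Any sufficient fuel gives the same value, so values computed at [x], [2x] and [3x] with
    unrelated fuels can be compared. *)
Lemma extend_stable {R : realType} {e : R} (f : R -> R) (n m : nat) (x : R) :
  0 < e -> depth e n x -> depth e m x -> extend e f n x = extend e f m x.
Proof.
move=> e_gt0; elim: n m x => [|n IHn] [|m] x dn dm //.
- by rewrite !extend_base // depth0.
- by rewrite !extend_base // depth0.
rewrite /=; case: ifPn => [xe|_].
  have [n3 n2] := depth_small e_gt0 xe dn; have [m3 m2] := depth_small e_gt0 xe dm.
  by rewrite (IHn m) // (IHn m).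
case: ifPn => //; rewrite -leNgt => xe.
have [n3 n2] := depth_large e_gt0 xe dn; have [m3 m2] := depth_large e_gt0 xe dm.
by rewrite (IHn m) // (IHn m).
Qed.

Lemma half_line_existence {R : realType} (e : R) (f : R -> R) :
  0 < e -> exists y : R -> R,
  (forall x, 0 < x -> y (3 * x) = y x + y (2 * x)) /\
  (forall x, e <= x < 3 * e -> y x = f x).
Proof.
move=> e_gt0.
have /choice[N NP] (x : R) : exists n, 0 < x -> depth e n x.
  have [/(depth_ex x e_gt0)[n dn]|] := boolP (0 < x); first by exists n.
  by exists 0%N.
pose y x := extend e f (N x) x.
have yE n x : 0 < x -> depth e n x -> y x = extend e f n x.
  by move=> /NP dN dn; exact: extend_stable.
exists y; split; last by move=> x xe; exact: extend_base.
move=> x x_gt0.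
have x2_gt0 : 0 < 2 * x by lra.
have x3_gt0 : 0 < 3 * x by lra.
have x3K : 3 * x / 3 = x by lra.
(* A successor depth lets [extend] unfold once: at [x] if [x < e], at [3x] otherwise. *)
have deep z : 0 < z -> exists n, depth e n.+1 z.
  move=> z_gt0; have [n [h1 h2]] := depth_ex z e_gt0 z_gt0.
  by exists n; rewrite /depth -(natr1 n); split; lra.
have [xe|ex] := ltP x e.
  have [n dn] := deep x x_gt0.
  have [d3 d2] := depth_small e_gt0 xe dn.
  by rewrite (yE _ _ x_gt0 dn) (yE _ _ x2_gt0 d2) (yE _ _ x3_gt0 d3) /= xe subrK.
have ex3 : 3 * e <= 3 * x by lra.
have [n dn] := deep (3 * x) x3_gt0.
have [] := depth_large e_gt0 ex3 dn; rewrite x3K => d1 d2.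
rewrite (yE _ _ x_gt0 d1) (yE _ _ x2_gt0 d2) (yE _ _ x3_gt0 dn) /= x3K.
by rewrite [3 * x < 3 * e]ltNge ex3 /= ifF //; apply/negbTE; rewrite -leNgt; lra.
Qed.

Lemma half_line_uniqueness {R : realType} (e : R) (y z : R -> R) :
  0 < e ->
  (forall x, 0 < x -> y (3 * x) = y x + y (2 * x)) ->
  (forall x, 0 < x -> z (3 * x) = z x + z (2 * x)) ->
  (forall x, e <= x < 3 * e -> y x = z x) ->
  forall x, 0 < x -> y x = z x.
Proof.
move=> e_gt0 yP zP yz x x_gt0; have [n] := depth_ex x e_gt0 x_gt0.
elim: n x x_gt0 => [|n IHn] x x_gt0 dn; first exact/yz/depth0.
have [xe|ex] := ltP x e.
  have [d3 d2] := depth_small e_gt0 xe dn.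
  (* By induction [y] and [z] agree at [3x] and [2x]; cancelling the term at [2x] leaves
     [y x = z x]. *)
  have := yP x x_gt0; rewrite (IHn (3 * x)) ?(IHn (2 * x)) //; try lra.
  by rewrite zP // => /addIr.
have [xe|xe] := ltP x (3 * e); first by rewrite yz // ex.
have [d1 d2] := depth_large e_gt0 xe dn.
have -> : x = 3 * (x / 3) by lra.
by rewrite yP ?zP ?IHn //; lra.
Qed.

Theorem theorem5p5 (R : realType) (delta eps : R)
    (hdelta : 0 < delta) (heps : 0 < eps) (y0 : I0 delta eps -> R) :
  exists! y : R -> R,
    (forall x : R, y (3 * x) = y x + y (2 * x)) /\
    (forall x : I0 delta eps, y (\val x) = y0 x).
Proof.
have posI0 x : eps <= x < 3 * eps -> x \in I0 delta eps.
  by move=> h; rewrite inE; right; rewrite /= in_itv.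
have negI0 x : delta <= x < 3 * delta -> - x \in I0 delta eps.
  move=> /andP[h1 h2]; rewrite inE; left.
  by rewrite /= in_itv /= lerN2 ltrN2 h1 h2.
(* [y0] is extended by 0 outside [I0]; only values on [I0] matter below. *)
pose f x := if insub x is Some u then y0 u else 0.
have [p [pP pf]] := half_line_existence eps f heps.
have [q [qP qf]] := half_line_existence delta (fun x => f (- x)) hdelta.
exists (fun x => if 0 < x then p x else if x < 0 then q (- x) else 0).
split; first split.
- move=> x; have [x_gt0|x_lt0|->] := ltrgt0P x.
  + by rewrite !pmulr_rgt0 // x_gt0 pP.
  + rewrite !pmulr_rgt0 // !pmulr_rlt0 // x_lt0 ltNge (ltW x_lt0) /=.
    by rewrite -!mulrN qP // oppr_gt0.
  + by rewrite !mulr0 ltxx addr0.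
- move=> u; have fu : f (\val u) = y0 u by rewrite /f valK.
  have := valP u; rewrite /I0 inE -fu => -[] /=; rewrite in_itv /= => /andP[h1 h2].
  + rewrite ifF; last by apply/negbTE; rewrite -leNgt; lra.
    rewrite ifT; last by lra.
    by rewrite qf ?opprK //; apply/andP; split; lra.
  + rewrite ifT; last by lra.
    by rewrite pf // h1 h2.
move=> z [zP z0]; apply/funext => x.
have zf t : t \in I0 delta eps -> z t = f t.
  by move=> tI; rewrite -[t](@SubK _ _ (I0 delta eps) t tI) z0 /f valK.
have [x_gt0|x_lt0|->] := ltrgt0P x.
- apply: (half_line_uniqueness eps p z heps pP) => // t te.
  by rewrite pf // zf // posI0.
(* The equation is preserved by [x -> - x], so the reflection of [z] is compared with [q]. *)
- have -> : z x = (z \o -%R) (- x) by rewrite /= opprK.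
  apply: (half_line_uniqueness delta q (z \o -%R) hdelta qP); last by lra.
  + by move=> t _ /=; rewrite -!mulrN zP.
  + by move=> t td /=; rewrite qf // zf // negI0.
(* At 0 the equation reads [z 0 = z 0 + z 0]. *)
- by have := zP 0; rewrite !mulr0; lra.
Qed.
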